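(* Fix an integer $n>2$. Let $c$ be a nonzero square-free integer with $c\ne\pm1$. For $d\in\mathbb{Z}$ let $g_d(x)=x^n+cx^{n-1}+cd$, and consider those $d$ for which $g_d$ is irreducible, with $\theta_d$ a root of $g_d$. Let \[B=\frac{6}{\pi^2}\prod_{p\mid c}\frac{p}{p+1}-\left(1-\frac{6}{\pi^2}\prod_{p\mid n}\frac{p^2}{p^2-1}\right),\] where the products run over primes. Then $B$ is a lower bound on the natural density of the set of integers $d$ such that $\mathbb{Z}[\theta_d]$ is the full ring of integers of $\mathbb{Q}(\theta_d)$. In particular, if $c$ has exactly one prime factor, or $c$ has exactly two prime factors and is coprime to $6$, then $B>0$ and there are infinitely many such $d$.
   Context: For a set $A$ of integers, its natural density is $\lim_{x\to\infty}\#\{a\in A: a\le x\}/x$ (taken over the relevant counting of integers); ''$B$ is a lower bound on the density'' means this proportion is asymptotically at least $B$. *)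

(* Defs.v *)
From HB Require Import structures.
From mathcomp Require Import all_boot all_order all_algebra all_field.
From mathcomp Require Import boolp reals trigo.
Set Implicit Arguments. Unset Strict Implicit. Unset Printing Implicit Defensive.
Import Order.TTheory GRing.Theory Num.Theory.
Local Open Scope ring_scope.

Definition squarefree (c : int) : Prop :=
  forall p : nat, prime p -> ~~ (p * p %| `|c|)%N.

Definition gpoly (n : nat) (c d : int) : {poly rat} :=
  'X^n + (c%:~R : rat) *: 'X^(n.-1) + ((c * d)%:~R : rat)%:P.

Definition in_Qadj (t x : algC) : Prop :=
  exists p : {poly rat}, x = (map_poly (fun q : rat => ratr q) p).[t].

Definition in_Zadj (t x : algC) : Prop :=
  exists p : {poly int}, x = (map_poly (fun z : int => z%:~R) p).[t].

Definition Zadj_is_ring_of_integers (t : algC) : Prop :=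
  forall x : algC, (in_Qadj t x /\ x \in Aint) <-> in_Zadj t x.

(* the set of d of the theorem: g_d irreducible and Z[theta_d] = O_{Q(theta_d)}
   for a root theta_d (all roots of an irreducible polynomial are conjugate,
   so we require it for every complex root). *)
Definition good_d (n : nat) (c d : int) : Prop :=
  irreducible_poly (gpoly n c d) /\
  forall t : algC, root (map_poly (fun q : rat => ratr q) (gpoly n c d)) t ->
    Zadj_is_ring_of_integers t.

Definition count_sym (S : int -> Prop) (N : nat) : nat :=
  #|[set k : 'I_(2 * N).+1 | `[< S (k%:Z - N%:Z) >] ]|.

(* "B is a lower bound on the natural density of S":
   liminf_{N -> oo} #{d in S : |d| <= N} / (2N+1) >= B *)
Definition density_lower_bound (R : realType) (S : int -> Prop) (B : R) : Prop :=
  forall eps : R, 0 < eps -> exists N0 : nat, forall N : nat, (N0 <= N)%N ->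
    B - eps <= (count_sym S N)%:R / ((2 * N).+1)%:R.

Definition Bconst (R : realType) (n : nat) (c : int) : R :=
  6 / (pi ^+ 2) * \prod_(p <- primes `|c|) (p%:R / (p%:R + 1))
  - (1 - 6 / (pi ^+ 2) * \prod_(p <- primes n) (p%:R ^+ 2 / (p%:R ^+ 2 - 1))).

(* Main.v *)
Require Import Defs.
From mathcomp Require Import all_boot all_order all_algebra all_field.
From mathcomp Require Import boolp classical_sets reals topology normedtype.
From mathcomp Require Import derive realfun trigo.
From mathcomp Require Import ring lra zify.
Set Implicit Arguments. Unset Strict Implicit. Unset Printing Implicit Defensive.
Import Order.TTheory GRing.Theory Num.Theory.
Import numFieldNormedType.Exports.
Local Open Scope ring_scope.

(** Write h(d) = n^n d + (-(n-1)c)^(n-1). If d is squarefree and coprime to c,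
    and p^2 does not divide h(d) for any prime p not dividing n, then Z[theta_d]
    is maximal at every prime p: modulo p, g_d is (x - r)^e q with (x - r) q
    separable, and either e = 0 or p divides g_d(r) exactly once (Dedekind's
    criterion, proved directly for such polynomials). Here r = 0 if p | cd, and
    otherwise r is the critical point -(n-1)c/n, where n^n g_d(r) = c h(d).
    Irreducibility is Eisenstein's criterion at a prime factor of c.

    Both conditions on d say that linear forms in d avoid the multiples of p or
    of p^2. By the Chinese remainder theorem the small primes contribute an
    exact product, and the primes p > y exclude a proportion at most 1/y + o(1)
    because the forms are linear. The products are bounded below by
    prod_p (1 - p^-2) >= 6/pi^2, which only needs the half
    sum 1/(2k+1)^2 <= pi^2/8 of Euler's formula; it follows from sin x <= x and
    the exact evaluation of sum 1/sin^2 over the odd multiples of pi/2^(m+2).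
    The two conditions are combined by |A inter B| >= |A| + |B| - total, and
    B > 0 reduces to pi^2 < 10. *)

(** * Maximality of Z[t] at a prime *)

Definition evalZ (t : algC) (f : {poly int}) : algC :=
  (map_poly intr f).[t].

Section EvalZ.
Variable t : algC.

Lemma evalZD f g : evalZ t (f + g) = evalZ t f + evalZ t g.
Proof. by rewrite /evalZ rmorphD hornerD. Qed.
Lemma evalZN f : evalZ t (- f) = - evalZ t f.
Proof. by rewrite /evalZ rmorphN hornerN. Qed.
Lemma evalZM f g : evalZ t (f * g) = evalZ t f * evalZ t g.
Proof. by rewrite /evalZ rmorphM hornerM. Qed.
Lemma evalZXn f k : evalZ t (f ^+ k) = evalZ t f ^+ k.
Proof. by rewrite /evalZ rmorphXn horner_exp. Qed.
Lemma evalZC (z : int) : evalZ t z%:P = z%:~R.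
Proof. by rewrite /evalZ map_polyC hornerC. Qed.
Lemma evalZX : evalZ t 'X = t.
Proof. by rewrite /evalZ map_polyX hornerX. Qed.
Lemma evalZ_sum I (s : seq I) (F : I -> {poly int}) :
  evalZ t (\sum_(i <- s) F i) = \sum_(i <- s) evalZ t (F i).
Proof. by rewrite /evalZ rmorph_sum horner_sum. Qed.
Definition evalZE := (evalZD, evalZN, evalZM, evalZXn, evalZC, evalZX).

Lemma in_ZadjP x : in_Zadj t x <-> exists f, x = evalZ t f.
Proof. by []. Qed.

Lemma in_Zadj_evalZ f : in_Zadj t (evalZ t f).
Proof. by exists f. Qed.

Lemma in_ZadjB x y : in_Zadj t x -> in_Zadj t y -> in_Zadj t (x - y).
Proof.
by move=> /in_ZadjP[f ->] /in_ZadjP[g ->]; exists (f - g); rewrite -evalZN -evalZD.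
Qed.

Lemma in_ZadjM x y : in_Zadj t x -> in_Zadj t y -> in_Zadj t (x * y).
Proof.
by move=> /in_ZadjP[f ->] /in_ZadjP[g ->]; exists (f * g); rewrite -evalZM.
Qed.

Lemma in_Zadj_int (z : int) : in_Zadj t z%:~R.
Proof. by exists z%:P; rewrite -/(evalZ t _) evalZC. Qed.

Lemma in_ZadjMl (z : int) x : in_Zadj t x -> in_Zadj t (z%:~R * x).
Proof. exact/in_ZadjM/in_Zadj_int. Qed.

End EvalZ.

Lemma Aint_monic_root (x : algC) : x \in Aint ->
  exists2 m : {poly int}, m \is monic & evalZ x m = 0.
Proof.
move=> /floorpP[m Dm]; exists m; last by rewrite /evalZ -Dm; exact/rootP/root_minCpoly.
have := minCpoly_monic x; rewrite Dm !monicE lead_coef_map_inj //; last exact: intr_inj.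
by rewrite -[1]/(1%:~R) eqr_int.
Qed.

(* Multiplying an integral equation of [a] of degree [k] by [y ^+ k]. *)
Lemma Aint_homogenize (t a : algC) (y f : {poly int}) : a \in Aint ->
  evalZ t f = evalZ t y * a ->
  exists k (w : {poly int}), (0 < k)%N /\ evalZ t (f ^+ k + y * w) = 0.
Proof.
move=> /Aint_monic_root[m mon_m ma0] fya.
have lm := monicP mon_m.
have sm : (1 < size m)%N.
  rewrite ltn_neqAle size_poly_gt0 monic_neq0 // andbT.
  apply: contra_eqN ma0 => /eqP/esym/eqP/size_poly1P[z z0 ->].
  by rewrite evalZC intr_eq0.
have sk : size m = (size m).-1.+1 by case: (size m) sm.
set k := (size m).-1 in sk.
have k0 : (0 < k)%N by rewrite -ltnS -sk.
exists k, (\sum_(i < k) (m`_i)%:P * y ^+ (k.-1 - i) * f ^+ i); split=> //.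
move: ma0; rewrite /evalZ horner_coef size_map_inj_poly ?rmorph0 //; last exact: intr_inj.
rewrite sk big_ord_recr /= coef_map /= -[m`_k]lead_coefE lm mul1r => ma0.
rewrite -/(evalZ t _) !evalZE evalZ_sum fya.
rewrite [X in _ + X](_ : _ = evalZ t y ^+ k *
   (\sum_(i < k) (map_poly intr m)`_i * a ^+ i)); last first.
  rewrite !mulr_sumr; apply: eq_bigr => i _.
  rewrite !evalZE fya exprMn coef_map /=.
  have -> : evalZ t y ^+ k =
      evalZ t y * evalZ t y ^+ (k.-1 - i) * evalZ t y ^+ i.
    rewrite -exprS -exprD; congr (_ ^+ _).
    by rewrite addSn subnK ?prednK // -ltnS prednK.
  by ring.
by rewrite exprMn -mulrDr addrC ma0 mulr0.
Qed.

(** A separable [q] is squarefree, so the cofactor [u] of [gcdp q f] in [q] is coprime to that gcd,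
    hence to [f]. As [u] divides [f ^+ k], it is constant. *)
Lemma separable_dvd_exp (F : fieldType) (q f : {poly F}) k :
  separable_poly q -> q %| f ^+ k -> q %| f.
Proof.
move=> sq qf; have q0 := separable_poly_neq0 sq.
have /dvdpP[u uE] := dvdp_gcdl q f.
have := sq; rewrite uE separable_mul => /and3P[_ _ cou].
have cuf : coprimep u f.
  rewrite coprimep_def; apply/eqP.
  have : coprimep (gcdp u f) (gcdp u f).
    have d1 : gcdp u f %| gcdp q f.
      by rewrite dvdp_gcd dvdp_gcdr (dvdp_trans (dvdp_gcdl _ _)) // uE dvdp_mulr.
    exact: coprimep_dvdr (dvdp_gcdl u f) (coprimep_dvdl d1 cou).
  by rewrite coprimepp => /eqP.
have : u %| f ^+ k by apply: dvdp_trans qf; rewrite uE dvdp_mulr.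
rewrite -[f ^+ k]mulr1 Gauss_dvdpr ?coprimep_expr // dvdp1 => /eqP su.
have /eqp_dvdl -> : u * gcdp q f %= gcdp q f.
  have /size_poly1P[z z0 ->] : size u == 1 by rewrite su.
  by rewrite mul_polyC eqp_scale.
exact: dvdp_gcdr.
Qed.

Section ReductionModP.
Variable p : nat.
Hypothesis p_pr : prime p.

Local Notation redp := (map_poly (intr : int -> 'F_p)).

Lemma intr_Fp_eq0 (z : int) : (z%:~R == 0 :> 'F_p) = (p %| z)%Z.
Proof. by rewrite (dvdz_pcharf (pchar_Fp p_pr)). Qed.

Lemma redp_lift (q : {poly 'F_p}) : exists s : {poly int}, redp s = q.
Proof.
exists (map_poly (fun x : 'F_p => Posz x) q).
apply/polyP => i; rewrite coef_map /= coef_map_id0 //=.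
by rewrite -pmulrn natr_Zp.
Qed.

Lemma redp_dvdP (f h : {poly int}) : redp h %| redp f ->
  exists s u, f = h * s + (p%:Z)%:P * u.
Proof.
move=> /dvdpP[s' sE]; have [s ss] := redp_lift s'.
pose u := map_poly (fun z => (z %/ p)%Z) (f - h * s).
exists s, u; apply/eqP; rewrite addrC -subr_eq; apply/eqP/polyP => i.
rewrite mul_polyC coefZ coef_map_id0 ?div0z // [RHS]mulrC divzK //.
rewrite -intr_Fp_eq0 -[_%:~R]/(intr _) -(coef_map intr) rmorphB rmorphM /= ss sE.
by rewrite mulrC subrr coef0.
Qed.

End ReductionModP.

Section Order.
Variables (g : {poly int}) (t : algC).
Hypothesis g_monic : g \is monic.
Hypothesis g_irr : irreducible_poly (map_poly (intr : int -> rat) g).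
Hypothesis g_root : evalZ t g = 0.

(** Division by the monic [g] stays over the integers. The remainder vanishes at [t] and has lower
    degree than [g], which is the minimal polynomial of [t] up to a scalar, so it is zero. *)
Lemma evalZ_eq0_dvd u : evalZ t u = 0 -> exists v, u = g * v.
Proof.
move=> ut0; have uE := Pdiv.RingMonic.rdivp_eq g_monic u.
set q := Pdiv.Ring.rdivp u g in uE; set r := Pdiv.Ring.rmodp u g in uE.
exists q; rewrite uE mulrC addrC -[RHS]add0r; congr (_ + _).
have rt0 : evalZ t r = 0.
  by move: ut0; rewrite uE evalZD evalZM g_root mulr0 add0r.
have toC (f : {poly int}) :
    map_poly ratr (map_poly (intr : int -> rat) f) = map_poly (intr : int -> algC) f.
  by rewrite -map_poly_comp; apply: eq_map_poly => b; rewrite /= rmorph_int.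
have [m [mE mon_m] mP] := minCpolyP t.
have mg : m %| map_poly intr g by rewrite -mP toC; apply/rootP.
have mr : m %| map_poly intr r by rewrite -mP toC; apply/rootP.
have sm : size m != 1.
  apply/eqP => /eqP/size_poly1P[z z0 mz].
  have := root_minCpoly t; rewrite mE mz map_polyC /= rootC fmorph_eq0.
  by rewrite (negPf z0).
have /eqp_dvdl mgE := g_irr.2 _ sm mg.
apply/eqP/negP => /negP r0; move: mr; rewrite mgE => /dvdp_leq.
rewrite map_poly_eq0_id0 ?intr_eq0 ?lead_coef_eq0 // => /(_ r0).
rewrite !size_map_inj_poly ?rmorph0 //; try exact: intr_inj.
by rewrite leqNgt Pdiv.Ring.ltn_rmodp monic_neq0.
Qed.

Section Prime.
Variable p : nat.
Hypothesis p_pr : prime p.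

(* With [v t = (t - r) b], the integral equation of [b] forces [p | v.[r]];
   as [g.[r] = p w0] is a multiple of [t - r], this puts [w0 b], hence [b],
   in [Z[t]]. *)
Lemma Zadj_descent (r : int) (b : algC) :
  (p %| g.[r])%Z -> ~~ ((p ^ 2)%N %| g.[r])%Z ->
  b \in Aint -> in_Zadj t (p%:R * b) -> in_Zadj t ((t - r%:~R) * b) ->
  in_Zadj t b.
Proof.
move=> pg p2g bA pb [v vE].
have p0 : p%:Z != 0 by rewrite -lt0n prime_gt0.
have vE' : evalZ t v = evalZ t ('X - r%:P) * b by rewrite !evalZE vE.
have [k [w [k0 /evalZ_eq0_dvd[z zE]]]] := Aint_homogenize bA vE'.
have pv : (p %| v.[r])%Z.
  have : (p %| v.[r] ^+ k)%Z.
    have := congr1 (fun f => f.[r]) zE.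
    rewrite !hornerE /= subrr mul0r addr0 => ->.
    exact: dvdz_mulr.
  by rewrite !dvdzE abszX Euclid_dvdX // k0 andbT.
have [v2 v2E] := dvdzP pv; have [w0 w0E] := dvdzP pg.
have [v1 v1E] : exists v1, v = ('X - r%:P) * v1 + v.[r]%:P.
  have /factor_theorem[v1 e] : root (v - v.[r]%:P) r.
    by rewrite rootE !hornerE subrr.
  by exists v1; rewrite mulrC -e subrK.
have [g1 g1E] : exists g1, g = ('X - r%:P) * g1 + g.[r]%:P.
  have /factor_theorem[v1' e] : root (g - g.[r]%:P) r.
    by rewrite rootE !hornerE subrr.
  by exists v1'; rewrite mulrC -e subrK.
have tr : t - r%:~R != 0.
  apply: contraNneq p2g => tr.
  have := g_root; rewrite {1}g1E !evalZE tr mul0r add0r => /eqP.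
  by rewrite intr_eq0 => /eqP ->; exact: dvdz0.
have w0b : in_Zadj t (w0%:~R * b).
  (* Since [g] vanishes at [t], [(t - r) * g1(t) = - w0 * p]; so the term [w0 * p * v2] of
     [w0 * v(t)] is a multiple of [t - r] too, and [t - r] cancels. *)
  suff -> : w0%:~R * b = evalZ t (w0%:P * v1 - g1 * v2%:P) by exact: in_Zadj_evalZ.
  apply: (mulfI tr); rewrite mulrCA.
  have -> : (t - r%:~R) * b = evalZ t v by rewrite vE.
  rewrite {1}v1E v2E !evalZE intrM.
  have : (t - r%:~R) * evalZ t g1 + w0%:~R * p%:~R = 0.
    by rewrite -intrM -w0E -[RHS]g_root [in RHS]g1E !evalZE.
  move=> /(congr1 (fun x => x * v2%:~R)); rewrite mul0r => e0.
  apply/eqP; rewrite -subr_eq0 -e0; apply/eqP; ring.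
have co : coprimez p w0.
  rewrite /coprimez /gcdz /= -[_ == _]/(coprime p `|w0|) prime_coprime //.
  apply: contra p2g => pw; rewrite w0E dvdzE abszM mulnC /= -mulnn.
  exact: dvdn_mul.
have [[x y] xy] := coprimezP _ _ co.
have -> : b = x%:~R * (p%:R * b) - (- y)%:~R * (w0%:~R * b).
  have : (x * p + y * w0)%:~R = 1 :> algC by rewrite xy.
  rewrite intrD !intrM => xyC.
  by rewrite intrN mulNr opprK pmulrn !mulrA -mulrDl xyC mul1r.
by apply: in_ZadjB; exact: in_ZadjMl.
Qed.


Local Notation redp := (map_poly (intr : int -> 'F_p)).

(** The integral equation of [a], cleared of denominators, says that a power of [f] lies in the
    ideal generated by [g] and [p]. Thus [h] divides this power modulo [p], and separability removes
    the exponent. *)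
Lemma Zadj_radical (h f : {poly int}) (a : algC) : separable_poly (redp h) ->
  redp h %| redp g -> a \in Aint -> p%:R * a = evalZ t f ->
  exists s u, f = h * s + (p%:Z)%:P * u.
Proof.
move=> sh hg aA faE; apply: (redp_dvdP p_pr).
have fE : evalZ t f = evalZ t (p%:Z)%:P * a by rewrite evalZC -faE.
have [k [w [k0 /evalZ_eq0_dvd[z zE]]]] := Aint_homogenize aA fE.
apply: (@separable_dvd_exp _ _ _ k sh); rewrite -rmorphXn.
have -> : f ^+ k = g * z - (p%:Z)%:P * w by rewrite -zE addrK.
have p0 : redp (p%:Z)%:P = 0.
  by rewrite map_polyC /=; apply/eqP; rewrite polyC_eq0 (intr_Fp_eq0 p_pr) dvdzz.
by rewrite rmorphB !rmorphM /= p0 mul0r subr0 dvdp_mulr.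
Qed.

Lemma pmaximal_separable (a : algC) : separable_poly (redp g) ->
  a \in Aint -> in_Zadj t (p%:R * a) -> in_Zadj t a.
Proof.
move=> sg aA [f faE].
have [s [u fE]] := Zadj_radical sg (dvdpp _) aA faE.
exists u; apply: (@mulfI _ p%:R); first by rewrite pnatr_eq0 -lt0n prime_gt0.
by rewrite faE -!/(evalZ t _) fE !evalZE g_root mul0r add0r.
Qed.

(** By [Zadj_radical], [p * a] is a multiple of [(t - r) * q(t)] up to [p * Z[t]]. A further factor
    [(t - r) ^+ e.-1] completes it to [(t - r) ^+ e * q(t)], which is divisible by [p] because [g]
    vanishes at [t]. So [(t - r) ^+ e.-1 * a] is in [Z[t]], and [Zadj_descent] strips the factors
    [t - r] one by one. *)
Lemma pmaximal_simple_root (r : int) (e : nat) (q : {poly int}) (a : algC) :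
  (0 < e)%N -> redp g = redp (('X - r%:P) ^+ e * q) ->
  separable_poly (redp (('X - r%:P) * q)) ->
  (p %| g.[r])%Z -> ~~ ((p ^ 2)%N %| g.[r])%Z ->
  a \in Aint -> in_Zadj t (p%:R * a) -> in_Zadj t a.
Proof.
move=> e0 gE sq pg p2g aA pa; case: (pa) => f faE.
have p0 : p%:R != 0 :> algC by rewrite pnatr_eq0 -lt0n prime_gt0.
have tA : t \in Aint.
  apply: (@root_monic_Aint (map_poly intr g)).
  - exact/rootP.
  - exact: monic_map.
  by apply/polyOverP => i; rewrite coef_map; apply: intr_int.
have rg : redp (('X - r%:P) * q) %| redp g.
  by rewrite gE -(prednK e0) exprS -mulrA mulrCA [X in _ %| X]rmorphM dvdp_mull.
have [s [u fE]] := Zadj_radical sq rg aA faE.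
have [s' [w wE]] : exists s w, ('X - r%:P) ^+ e * q - g = 0 * s + (p%:Z)%:P * w.
  by apply: (redp_dvdP p_pr); rewrite rmorphB /= -gE subrr dvdp0.
have top : in_Zadj t ((t - r%:~R) ^+ e.-1 * a).
  exists (w * s + ('X - r%:P) ^+ e.-1 * u); apply: (mulfI p0).
  rewrite -/(evalZ t _) mulrCA faE -/(evalZ t _) fE !evalZE.
  have := congr1 (evalZ t) wE.
  rewrite -{1}(prednK e0) exprS !evalZE g_root mul0r add0r subr0 => wt.
  by rewrite pmulrn [RHS]mulrDr [in RHS]mulrA -wt; ring.
elim: e.-1 top => [|j IHj]; first by rewrite expr0 mul1r.
rewrite exprS -mulrA => tj; apply: IHj; apply: (Zadj_descent pg p2g) => //.
  by rewrite rpredM ?rpredX ?rpredB // Aint_int.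
rewrite mulrCA; apply: in_ZadjM => //.
by exists (('X - r%:P) ^+ j); rewrite -/(evalZ t _) !evalZE.
Qed.

End Prime.
End Order.

(** Some positive multiple [k * x] lies in [Z[t]]; strong induction on [k] removes one prime factor
    of it at a time. *)
Lemma Zadj_is_ring_of_integersP (t : algC) : t \in Aint ->
  (forall p a, prime p -> a \in Aint -> in_Zadj t (p%:R * a) -> in_Zadj t a) ->
  Zadj_is_ring_of_integers t.
Proof.
move=> tA pmax x; split=> [[[f xE] xA]|[f ->]]; last first.
  split; last first.
    rewrite horner_coef rpred_sum // => i _.
    by rewrite coef_map rpredM ?rpredX // Aint_int.
  exists (map_poly intr f); rewrite -map_poly_comp; congr (_.[t]).
  by apply: eq_map_poly => z; rewrite /= rmorph_int.
have [q [k k0 fE]] := rat_poly_scale f.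
have : exists2 k : nat, (0 < k)%N & in_Zadj t (k%:R * x).
  exists `|k|%N; first by rewrite absz_gt0.
  (* The denominator [k] may be negative; its sign makes up for passing to the absolute value. *)
  apply/in_ZadjP; exists ((Num.sg k)%:P * q); rewrite evalZM evalZC xE fE.
  rewrite map_polyZ hornerZ /= fmorphV rmorph_int.
  rewrite -map_poly_comp (eq_map_poly (g := intr)); last first.
    by move=> z; rewrite /= rmorph_int.
  rewrite mulrA; congr (_ * _); apply: (@mulIf _ k%:~R); first by rewrite intr_eq0.
  by rewrite mulfVK ?intr_eq0 // -intrM -normrEsg -abszE pmulrn.
case=> {xE fE k0}k k0; elim/ltn_ind: k k0 x xA => k IHk k0 x xA kx.
have [k1|k1] := leqP k 1.
  have kE : k = 1%N by apply/eqP; rewrite eqn_leq k1.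
  by move: kx; rewrite kE mul1r.
have pp := pdiv_prime k1; have kE := divnK (pdiv_dvd k).
apply: (pmax (pdiv k)) => //; apply: (IHk (k %/ pdiv k)%N).
- by rewrite ltn_Pdiv // prime_gt1.
- by rewrite divn_gt0 ?prime_gt0 // dvdn_leq // pdiv_dvd.
- by rewrite rpredM // Aint_Cnat.
by rewrite mulrA -natrM kE.
Qed.

(** * Separability and double roots of trinomials over a field *)

Section TrinomialField.
Variables (F : fieldType) (m : nat) (a b r : F).
Let g := 'X^(m.+2) + a *: 'X^(m.+1) + b%:P.
Hypothesis b0 : b != 0.

Let g0 : g.[0] = b.
Proof. by rewrite /g !hornerE !expr0n /= mulr0 !add0r. Qed.

Let g' : g^`() = 'X^m * (m.+2%:R *: 'X + (m.+1%:R * a)%:P).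
Proof.
rewrite /g !derivD derivZ !derivXn derivC addr0 /= mulrDr -scalerAr -exprSr.
by rewrite scaler_nat [_ * _%:P]mulrC mul_polyC -scalerA scaler_nat -scalerMnr.
Qed.

(** With [n = m.+2], the derivative is ['X^m] times a linear factor, and [0] is not a root of [g].
    If [n = 0] in [F], the linear factor is the constant [- a]; otherwise its root is [r]. *)
Lemma trinomial_separable :
  (m.+2%:R = 0 :> F -> a != 0) ->
  (m.+2%:R != 0 :> F -> m.+2%:R * r = - (m.+1%:R * a) /\ ~~ root g r) ->
  separable_poly g.
Proof.
move=> a0 gr; rewrite unlock g' coprimepMr; apply/andP; split.
  by apply: coprimep_expr; rewrite -['X]subr0 coprimep_XsubC rootE g0.
have [n0|n0] := eqVneq (m.+2%:R : F) 0.
  rewrite n0 scale0r add0r; apply: coprimep_dvdl (coprimep1 _).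
  rewrite dvdp1 size_polyC mulf_eq0 negb_or a0 // andbT.
  have -> : m.+1%:R = -1 :> F by apply/eqP; rewrite -subr_eq0 opprK natr1 n0.
  by rewrite oppr_eq0 oner_eq0.
have [rE {}gr] := gr n0.
have -> : m.+1%:R * a = - (m.+2%:R * r) by rewrite rE opprK.
by rewrite polyCN polyCM mul_polyC -scalerBr coprimepZr // coprimep_XsubC gr.
Qed.

(** Dividing the derivative of [('X - r) ^+ 2 * q] by ['X - r] gives
    [n * 'X^m = 2 * q + ('X - r) * q'] for [n = m.+2]. So a common factor of [q] and [q'] divides
    ['X^m], although [q] is nonzero at [0]; and a root of [q] at [r] would force
    [n * r ^+ m = 0]. *)
Lemma trinomial_double_root : m.+2%:R != 0 :> F ->
  m.+2%:R * r = - (m.+1%:R * a) -> root g r ->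
  exists q, g = ('X - r%:P) ^+ 2 * q /\ separable_poly (('X - r%:P) * q).
Proof.
move=> n0 rE gr; have r0 : r != 0 by apply: contraTneq gr => ->; rewrite rootE g0.
have g'r : g^`() = m.+2%:R *: ('X^m * ('X - r%:P)).
  rewrite g'; have -> : m.+1%:R * a = - (m.+2%:R * r) by rewrite rE opprK.
  by rewrite polyCN polyCM mul_polyC -scalerBr -scalerAr.
have /factor_theorem[q1 q1E] := gr.
have /factor_theorem[q qE] : root q1 r.
  have := congr1 (fun f => f^`().[r]) q1E; rewrite /= g'r derivM derivXsubC mulr1.
  rewrite hornerZ hornerD !hornerM hornerXsubC subrr !mulr0 add0r => /esym e.
  exact/rootP.
have gE : g = ('X - r%:P) ^+ 2 * q by rewrite q1E qE; ring.
exists q; split=> //.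
have q' : m.+2%:R *: 'X^m = q *+ 2 + ('X - r%:P) * q^`().
  apply: (@mulfI _ ('X - r%:P)); first by rewrite polyXsubC_eq0.
  rewrite -scalerAr mulrC -g'r gE derivM expr2 derivM derivXsubC; ring.
have q0 : ~~ root q 0.
  by apply: contra b0 => /rootP q00; rewrite -g0 gE hornerM q00 mulr0.
rewrite mulrC separable_root; apply/andP; split; last first.
  apply/negP => /rootP qr; have := congr1 (fun f => f.[r]) q'.
  rewrite hornerZ hornerXn hornerD hornerMn hornerM hornerXsubC qr subrr mul0r.
  rewrite mul0rn addr0 => /eqP.
  by rewrite mulf_eq0 expf_eq0 (negPf n0) (negPf r0) andbF.
rewrite unlock coprimep_def.
have : coprimep (gcdp q q^`()) (gcdp q q^`()).
  have d1 : gcdp q q^`() %| 'X^m.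
    rewrite -(dvdpZr _ _ n0) q' dvdp_add //; last exact: dvdp_mull (dvdp_gcdr _ _).
    by rewrite -mulr_natl dvdp_mull // dvdp_gcdl.
  apply: coprimep_dvdl d1 _; apply: coprimep_dvdr (dvdp_gcdl _ _) _.
  by apply: coprimep_expr; rewrite -['X]subr0 coprimep_XsubC.
by rewrite coprimepp.
Qed.

End TrinomialField.

(** * The integral trinomial and a criterion for good [d] *)

Definition gint (m : nat) (c d : int) : {poly int} :=
  'X^(m.+2) + c *: 'X^(m.+1) + (c * d)%:P.

(* Up to sign, the discriminant of [gint m c d] is
   [c ^+ n.-1 * d ^+ n.-2 * hdisc n c d] for [n = m.+2]. *)
Definition hdisc (n : nat) (c d : int) : int :=
  n%:Z ^+ n * d + (- (n.-1%:Z * c)) ^+ n.-1.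

Section Trinomial.
Variables (m : nat) (c d : int).
Local Notation g := (gint m c d).

Lemma map_gint (S : nzRingType) :
  map_poly (intr : int -> S) g =
  'X^(m.+2) + c%:~R *: 'X^(m.+1) + ((c * d)%:~R)%:P.
Proof. by rewrite /gint !rmorphD /= map_polyZ !map_polyXn map_polyC. Qed.

Lemma size_gint : size g = m.+3.
Proof.
rewrite /gint -addrA size_polyDl size_polyXn //.
rewrite (leq_ltn_trans (size_polyD _ _)) // gtn_max size_polyC.
rewrite (leq_ltn_trans (size_scale_leq _ _)) ?size_polyXn //.
by case: eqP.
Qed.

Lemma gint_monic : g \is monic.
Proof.
rewrite monicE lead_coefE size_gint /gint !coefE eqxx /= eqn_leq ltnn.
by rewrite mulr0 !addr0.
Qed.

Lemma horner_gint0 : g.[0] = c * d.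
Proof. by rewrite /gint !hornerE !expr0n /= mulr0 !add0r. Qed.

Lemma gint_irreducible p : prime p -> (p %| c)%Z ->
  ~~ ((p ^ 2)%N %| c * d)%Z -> irreducible_poly (map_poly (intr : int -> rat) g).
Proof.
move=> pp pc pcd; apply/irreducible_rat_int.
apply: (@eisenstein_crit p) => //.
- by rewrite size_gint.
- by rewrite (monicP gint_monic) dvdz1 /= gtn_eqF // prime_gt1.
- by rewrite -horner_coef0 horner_gint0.
rewrite size_gint /= => i im.
rewrite /gint !coefE (ltn_eqF im) add0r rpredD //.
  by rewrite dvdz_mulr.
by case: ifP => _ //; rewrite ?dvdz_mulr ?rpred0.
Qed.

(* The point [- (n - 1) c / n] is the nonzero critical point of the trinomial. *)
Lemma hdisc_horner (r k : int) :
  m.+2%:Z * r = - (m.+1%:Z * c) + k ->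
  exists z, m.+2%:Z ^+ m.+2 * g.[r] = c * hdisc m.+2 c d + k * z.
Proof.
move=> rE.
have [z zE] : exists z, (m.+2%:Z * r) ^+ m.+1 = (- (m.+1%:Z * c)) ^+ m.+1 + k * z.
  exists (\sum_(i < m.+1) (m.+2%:Z * r) ^+ (m - i) * (- (m.+1%:Z * c)) ^+ i).
  have -> : k = m.+2%:Z * r - (- (m.+1%:Z * c)) by rewrite rE addrC addKr.
  by rewrite -subrXX addrC subrK.
exists (z * (c + k) + (- (m.+1%:Z * c)) ^+ m.+1).
(* With [n = m.+2], the value [n ^+ n * g(r)] is [(n * r) ^+ n.-1 * (n * r + n * c) + n ^+ n * c *
   d]; the last factor of the first term is [c] up to the error [k]. *)
have sE : m.+2%:Z * r + c * m.+2%:Z = c + k.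
  rewrite rE (_ : m.+2%:Z = m.+1%:Z + 1); last by rewrite -PoszD addn1.
  by move: m.+1%:Z => N; ring.
rewrite /hdisc /= mulrDr [RHS]addrC.
have -> : m.+2%:Z ^+ m.+2 * g.[r] =
    (m.+2%:Z * r) ^+ m.+1 * (m.+2%:Z * r + c * m.+2%:Z) + m.+2%:Z ^+ m.+2 * (c * d).
  have eN : m.+2%:Z ^+ m.+2 = m.+2%:Z * m.+2%:Z ^+ m.+1 by rewrite exprS.
  have er : r ^+ m.+2 = r * r ^+ m.+1 by rewrite exprS.
  have gr : g.[r] = r ^+ m.+2 + c * r ^+ m.+1 + c * d by rewrite /gint !hornerE.
  rewrite gr exprMn er eN.
  by move: m.+2%:Z (m.+2%:Z ^+ m.+1) (r ^+ m.+1) => N A B; ring.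
rewrite zE sE.
by move: (m.+2%:Z ^+ m.+2) ((- (m.+1%:Z * c)) ^+ m.+1) => A B; ring.
Qed.

Lemma gint_pmaximal t p a : irreducible_poly (map_poly (intr : int -> rat) g) ->
  (forall p, prime p -> ~~ ((p ^ 2)%N %| c)%Z) ->
  (forall p, prime p -> (p %| c)%Z -> ~~ (p %| d)%Z) ->
  (forall p, prime p -> ~~ ((p ^ 2)%N %| d)%Z) ->
  (forall p, prime p -> ~~ (p %| m.+2)%N -> ~~ ((p ^ 2)%N %| hdisc m.+2 c d)%Z) ->
  evalZ t g = 0 -> prime p -> a \in Aint -> in_Zadj t (p%:R * a) -> in_Zadj t a.
Proof.
move=> irr c2 cd d2 h2 gt pp aA paA.
have co q : ~~ (p %| q)%Z -> coprimez (p ^ 2)%N q.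
  by move=> pq; rewrite coprimezE /= coprime_pexpl // prime_coprime.
have F0 z : ((z%:~R : 'F_p) == 0) = (p %| z)%Z by exact: intr_Fp_eq0.
pose redp := map_poly (intr : int -> 'F_p).
have [pc|pc] := boolP (p %| c)%Z.
  have pd := cd _ pp pc.
  (* Modulo [p] the trinomial is ['X^(m.+2)]. *)
  apply: (@pmaximal_simple_root g t gint_monic irr gt p pp 0 m.+2 1) => //.
  - rewrite map_gint mulr1 subr0 map_polyXn.
    have /eqP -> : c%:~R == 0 :> 'F_p by rewrite F0.
    have /eqP -> : (c * d)%:~R == 0 :> 'F_p by rewrite F0 dvdz_mulr.
    by rewrite scale0r polyC0 !addr0.
  - by rewrite subr0 mulr1 map_polyX unlock derivX coprimep1.
  - by rewrite horner_gint0 dvdz_mulr.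
  - by rewrite horner_gint0 Gauss_dvdzl ?co // c2.
have [pd|pd] := boolP (p %| d)%Z.
  have qE : redp ('X + c%:P) = 'X + (c%:~R)%:P.
    by rewrite /redp rmorphD /= map_polyX map_polyC.
  (* Modulo [p] the trinomial is ['X^(m.+1) * ('X + c)], with [c] nonzero. *)
  apply: (@pmaximal_simple_root g t gint_monic irr gt p pp 0 m.+1 ('X + c%:P)) => //.
  - rewrite map_gint subr0 [RHS]rmorphM /= -/redp qE /redp map_polyXn.
    have /eqP -> : (c * d)%:~R == 0 :> 'F_p by rewrite F0 dvdz_mull.
    by rewrite polyC0 addr0 mulrDr -exprSr [_ * _%:P]mulrC mul_polyC.
  - rewrite subr0 rmorphM /= -/redp qE /redp map_polyX mulrC.
    rewrite -{2}['X]subr0 separable_root; apply/andP; split.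
      by rewrite unlock derivD derivX derivC addr0 coprimep1.
    by rewrite rootE !hornerE F0.
  - by rewrite horner_gint0 dvdz_mull.
  - by rewrite horner_gint0 Gauss_dvdzr ?co // d2.
have cd0 : (c * d)%:~R != 0 :> 'F_p.
  by rewrite intrM mulf_eq0 negb_or !F0 pc.
have [pn|pn] := boolP (p %| m.+2)%N.
  apply: (pmaximal_separable gint_monic irr gt pp) => //.
  (* As [m.+2] vanishes modulo [p], there is no nonzero critical point; [0] is a placeholder for
     it. *)
  rewrite map_gint; apply: (@trinomial_separable _ _ _ _ 0 cd0) => [_|].
    by rewrite F0.
  by rewrite pmulrn F0 dvdzE pn.
(* The critical point is approximated modulo [p ^ 2], not just modulo [p], so that divisibility of
   [g.[r]] by [p ^ 2] can be passed on to [hdisc]. *)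
have [r [k rE]] : exists r k : int, m.+2%:Z * r = - (m.+1%:Z * c) + (p ^ 2)%N%:Z * k.
  have /coprimezP[[x y] /= xy] : coprimez (p ^ 2)%N m.+2 by exact: co.
  exists (- (m.+1%:Z * c) * y), (m.+1%:Z * c * x).
  have -> : - (m.+1%:Z * c) + (p ^ 2)%N%:Z * (m.+1%:Z * c * x) =
      - (m.+1%:Z * c) * (1 - x * (p ^ 2)%N%:Z) by ring.
  by rewrite -xy; ring.
have [z zE] := hdisc_horner rE.
have rF : m.+2%:R * r%:~R = - (m.+1%:R * c%:~R) :> 'F_p.
  have /eqP p0 : (p ^ 2)%N%:~R == 0 :> 'F_p by rewrite F0 dvdzE dvdn_exp.
  have := congr1 (intr : int -> 'F_p) rE.
  by rewrite intrD !intrM intrN intrM p0 mul0r addr0 -!pmulrn.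
have n0 : m.+2%:R != 0 :> 'F_p.
  by rewrite pmulrn F0.
have rg : root (redp g) r%:~R = (p %| g.[r])%Z.
  by rewrite rootE horner_map F0.
have [pg|pg] := boolP (p %| g.[r])%Z; last first.
  apply: (pmaximal_separable gint_monic irr gt pp) => //.
  rewrite map_gint; apply: (@trinomial_separable _ _ _ _ r%:~R cd0) => [n00|_].
    by rewrite n00 eqxx in n0.
  by split; rewrite // -map_gint -/redp rg.
have := rg; rewrite pg /redp map_gint.
move=> /(trinomial_double_root cd0 n0 rF)[q0 [q0E sq0]].
have [q qE] := redp_lift q0.
apply: (@pmaximal_simple_root g t gint_monic irr gt p pp r 2 q) => //.
- by rewrite map_gint q0E rmorphM rmorphXn rmorphB /= map_polyX map_polyC /= qE.
- by rewrite rmorphM rmorphB /= map_polyX map_polyC /= qE.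
apply: contra (h2 _ pp pn) => p2g.
have : ((p ^ 2)%N %| c * hdisc m.+2 c d)%Z.
  have -> : c * hdisc m.+2 c d = m.+2%:Z ^+ m.+2 * g.[r] - (p ^ 2)%N%:Z * k * z.
    by rewrite zE addrK.
  apply: rpredB; first exact: dvdz_mull.
  by apply: dvdz_mulr; apply: dvdz_mulr.
by rewrite Gauss_dvdzr // co.
Qed.
End Trinomial.

(** The first condition on [d] merges squarefree with coprime to [c] into a single forbidden modulus
    per prime, the form in which the sieve treats it. *)
Lemma good_d_criterion (n : nat) (c d : int) : (2 < n)%N ->
  c != 0 -> c != 1 -> c != -1 -> squarefree c ->
  (forall p, prime p -> ~ ((if (p %| `|c|)%N then p else p ^ 2)%N %| d)%Z) ->
  (forall p, prime p -> ~~ (p %| n)%N -> ~ ((p ^ 2)%N %| hdisc n c d)%Z) ->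
  good_d n c d.
Proof.
case: n => [|[|m]] // _ c0 c1 cN1 sqc dP hP.
have c2 p : prime p -> ~~ ((p ^ 2)%N %| c)%Z.
  by move=> pp; rewrite dvdzE /= -mulnn sqc.
have cd p : prime p -> (p %| c)%Z -> ~~ (p %| d)%Z.
  by move=> pp; rewrite dvdzE /= => pc; apply/negP; have := dP p pp; rewrite pc.
have d2 p : prime p -> ~~ ((p ^ 2)%N %| d)%Z.
  move=> pp; apply/negP => p2d; apply: (dP p pp); case: ifP => // _.
  by apply: dvdz_trans p2d; rewrite dvdzE dvdn_exp.
have ac : (1 < `|c|)%N.
  by move: c0 c1 cN1; case: (c) => [[|[|k]]|[|k]].
have irr : irreducible_poly (map_poly (intr : int -> rat) (gint m c d)).
  have pp := pdiv_prime ac; have pc : (pdiv `|c| %| c)%Z by rewrite dvdzE pdiv_dvd.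
  apply: (@gint_irreducible m c d _ pp pc _); rewrite Gauss_dvdzl ?c2 //.
  by rewrite coprimezE /= coprime_pexpl // prime_coprime // cd.
have gE : gpoly m.+2 c d = map_poly intr (gint m c d) by rewrite map_gint.
split; first by rewrite gE.
move=> t; rewrite gE -map_poly_comp (eq_map_poly (g := intr)); last first.
  by move=> z; rewrite /= rmorph_int.
move=> /rootP gt; apply: Zadj_is_ring_of_integersP => [|p a pp].
  apply: (@root_monic_Aint (map_poly intr (gint m c d))).
  - exact/rootP.
  - exact/monic_map/gint_monic.
  by apply/polyOverP => i; rewrite coef_map; apply: intr_int.
by apply: (gint_pmaximal irr c2 cd d2) => // q qp qn; apply/negP/hP.
Qed.

(** * Euler products and pi *)

Section Trigo.
Variable R : realType.

(** By the mean value theorem. It drives a chain of Taylor bounds for [sin] and [cos], each one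
    obtained by integrating the previous one. *)
Lemma ge0_of_derive (f df : R -> R) : f 0 = 0 ->
  (forall x : R, is_derive x 1 f (df x)) -> (forall x, 0 <= x -> 0 <= df x) ->
  forall x, 0 <= x -> 0 <= f x.
Proof.
move=> f0 fd df0 x x0.
have fc : {within `[0, x], continuous f}%classic.
  by apply: derivable_within_continuous => z _; have [] := fd z.
have [y] := MVT_segment x0 (fun z _ => fd z) fc.
rewrite in_itv /= => /andP[y0 _]; rewrite f0 !subr0 => ->.
by rewrite mulr_ge0 ?df0.
Qed.

Lemma sin_le_id (x : R) : 0 <= x -> sin x <= x.
Proof.
move=> x0; rewrite -subr_ge0.
apply: (@ge0_of_derive (fun x => x - sin x) (fun x => 1 - cos x)) x0 => //.
- by rewrite sin0 subr0.
- by move=> z _; rewrite subr_ge0 cos_le1.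
Qed.

Lemma cos_ge_quadratic (x : R) : 0 <= x -> 1 - x ^+ 2 / 2 <= cos x.
Proof.
move=> x0; suff : 0 <= cos x - 1 + x ^+ 2 / 2 by lra.
apply: (@ge0_of_derive (fun x => cos x - 1 + x ^+ 2 / 2) (fun x => x - sin x)) x0 => //.
- by rewrite cos0 expr0n /= mul0r subrr addr0.
- by move=> z; apply: trigger_derive; rewrite /GRing.scale /=; lra.
- by move=> z z0; rewrite subr_ge0 sin_le_id.
Qed.

Lemma sin_ge_cubic (x : R) : 0 <= x -> x - x ^+ 3 / 6 <= sin x.
Proof.
move=> x0; suff : 0 <= sin x - x + x ^+ 3 / 6 by lra.
apply: (@ge0_of_derive (fun x => sin x - x + x ^+ 3 / 6)
  (fun x => cos x - 1 + x ^+ 2 / 2)) x0 => //.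
- by rewrite sin0 expr0n /= mul0r subrr addr0.
- by move=> z; apply: trigger_derive; rewrite /GRing.scale /=; lra.
- by move=> z z0; have := cos_ge_quadratic z0; lra.
Qed.

(** The triple angle formula at [3 * y = pi / 2] gives [4 * s ^+ 3 - 3 * s + 1 = 0], whose only
    positive root is [1 / 2]. *)
Lemma sin_pi6 : sin (pi / 6) = 2^-1 :> R.
Proof.
set y := pi / 6 : R; set s := sin y; set k := cos y.
have s0 : 0 < s.
  by apply: sin_gt0_pihalf; have := @pi_gt0 R; rewrite /y => h; apply/andP; split; lra.
have yE : pi / 2 = y *+ 2 + y :> R by rewrite /y; lra.
have := @sin_pihalf R; rewrite yE sinD sin_mulr2n cos_mulr2n -/s -/k => e.
have := cos2Dsin2 y; rewrite -/s -/k => e2.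
have : (s + 1) * (2 * s - 1) ^+ 2 = 0.
  have -> : (s + 1) * (2 * s - 1) ^+ 2 = 4 * s ^+ 3 - 3 * s + 1 by ring.
  have e3 : 2 * s * k ^+ 2 + (2 * k ^+ 2 - 1) * s = 1 by rewrite -[RHS]e; ring.
  have k2 : k ^+ 2 = 1 - s ^+ 2 by lra.
  by rewrite k2 in e3; lra.
move=> /eqP; rewrite mulf_eq0 expf_eq0 /= => /orP[/eqP|/eqP]; lra.
Qed.

(** For [y = pi / 6] and [u = y ^+ 2], the cubic bound on [sin y = 1 / 2] squares to
    [u * (1 - u / 6) ^+ 2 <= 1 / 4]. This fails at [u = 10 / 36], hence on all of
    [10 / 36 <= u < 4 / 9], where the left side increases; the upper end comes from [pi < 4]. *)
Lemma pi_sqr_lt10 : pi ^+ 2 < 10 :> R.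
Proof.
rewrite ltNge; apply/negP => pi10.
have p0 := @pi_gt0 R; have p4 : pi < 4 :> R by have := @pihalf_lt2 R; lra.
set y := pi / 6 : R; have y0 : 0 <= y by rewrite /y; lra.
have := sin_ge_cubic y0; rewrite sin_pi6 => ys.
have u1 : 10 / 36 <= y ^+ 2 by rewrite /y exprMn; lra.
have u2 : y ^+ 2 < 4 / 9.
  have : y < 2 / 3 by rewrite /y; lra.
  by nra.
have : (y - y ^+ 3 / 6) ^+ 2 <= (2^-1) ^+ 2.
  rewrite ler_pXn2r // nnegrE; last lra.
  have -> : y - y ^+ 3 / 6 = y * (1 - y ^+ 2 / 6) by ring.
  by rewrite mulr_ge0 //; lra.
have -> : (y - y ^+ 3 / 6) ^+ 2 = y ^+ 2 * (1 - y ^+ 2 / 6) ^+ 2 by ring.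
move: (y ^+ 2) u1 u2 => u u1 u2; nra.
Qed.

Definition ang (n k : nat) : R := (2 * k + 1)%:R * pi / 2 ^+ n.+2.

Lemma ang_itv n k : (k < 2 ^ n)%N -> 0 < ang n k < pi / 2.
Proof.
move=> kn; have p0 := @pi_gt0 R; apply/andP; split.
  by rewrite /ang divr_gt0 ?exprn_gt0 // mulr_gt0 // ltr0n addn1.
rewrite /ang ltr_pdivrMr ?exprn_gt0 //.
have -> : pi / 2 * 2 ^+ n.+2 = (2 ^ n.+1)%:R * pi :> R.
  by rewrite natrX [2 ^+ n.+2]exprS; field.
by rewrite ltr_pM2r // ltr_nat expnS; lia.
Qed.

Lemma ang_double n k : ang n k = ang n.+1 k *+ 2.
Proof.
have h : 2 ^+ n.+2 != 0 :> R by rewrite expf_neq0 ?pnatr_eq0.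
by rewrite /ang [2 ^+ n.+3]exprS; move: (2 ^+ n.+2) h => x h; field.
Qed.

Lemma ang_refl n k : (k < 2 ^ n)%N -> ang n (2 ^ n - k.+1) = pi / 2 - ang n k.
Proof.
move=> kn; rewrite /ang.
have -> : (2 * (2 ^ n - k.+1) + 1 = 2 ^ n.+1 - (2 * k + 1))%N by rewrite expnS; lia.
rewrite natrB; last by rewrite expnS; lia.
have : 2 ^+ n.+1 != 0 :> R by rewrite expf_neq0 ?pnatr_eq0.
rewrite natrX mulrBl mulrBl => h; congr (_ - _).
by rewrite [2 ^+ n.+2]exprS; move: (2 ^+ n.+1) h => x h; field.
Qed.

(* The angles [y] and [pi / 2 - y] contribute [sin y ^- 2 + cos y ^- 2 =
   4 * sin (y *+ 2) ^- 2], so each level is four times the previous one. *)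
Lemma sum_csc2 n : \sum_(k < 2 ^ n) (sin (ang n k)) ^- 2 = 2 * 4 ^+ n :> R.
Proof.
elim: n => [|n IHn].
  rewrite big_ord1 /ang /= mul1r expr0 mulr1; set y := pi / 2 ^+ 2.
  have yE : pi / 2 = y *+ 2 by rewrite /y; field.
  have := @sin_pihalf R; rewrite yE sin_mulr2n => e1; have e2 := cos2Dsin2 y.
  have : (cos y - sin y) ^+ 2 = 0 by lra.
  move=> /eqP; rewrite expf_eq0 /= subr_eq0 => /eqP cs.
  have -> : sin y ^+ 2 = 2^-1 by rewrite cs in e2; lra.
  by rewrite invrK.
rewrite exprS mulrCA -IHn mulr_sumr expnS mul2n -addnn big_split_ord /=.
(* Reversing the upper half of the finer level pairs each angle [y] with [pi / 2 - y]. *)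
rewrite [X in _ + X](reindex_inj rev_ord_inj) /= -big_split /=.
apply: eq_bigr => i _; have iN := ltn_ord i.
have iN1 : (i < 2 ^ n.+1)%N by rewrite expnS; lia.
have -> : (2 ^ n + (2 ^ n - i.+1) = 2 ^ n.+1 - i.+1)%N by rewrite expnS; lia.
rewrite ang_refl // [ang n i]ang_double; have := ang_itv iN1.
move: (ang n.+1 i) => y yI; have s0 := sin_gt0_pihalf yI.
have c0 : 0 < cos y.
  by apply: cos_gt0_pihalf; case/andP: yI => y0 ->; rewrite andbT; have := @pi_gt0 R; lra.
have -> : sin (pi / 2 - y) = cos y.
  by rewrite sinB sin_pihalf cos_pihalf mul1r mul0r subr0.
rewrite sin_mulr2n; have := cos2Dsin2 y.
move: s0 c0; move: (sin y) (cos y) => s c s0 c0 cs.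
have -> : s ^- 2 + c ^- 2 = (c ^+ 2 + s ^+ 2) / (s * c) ^+ 2 by field; rewrite !gt_eqF.
by rewrite cs; field; rewrite !gt_eqF.
Qed.

(** Extend the sum to [2 ^ K >= K] terms. Up to the factor [4 ^+ K.+2 / pi ^+ 2] these are the
    [ang K k ^- 2], which [sin x <= x] bounds by the terms of [sum_csc2]. *)
Lemma sum_odd_inv2 K : \sum_(k < K) ((2 * k + 1)%:R ^- 2 : R) <= pi ^+ 2 / 8.
Proof.
have p0 := @pi_gt0 R.
have le2 : \sum_(k < K) ((2 * k + 1)%:R ^- 2 : R) <= \sum_(k < 2 ^ K) (2 * k + 1)%:R ^- 2.
  rewrite -!(big_mkord xpredT (fun k => (2 * k + 1)%:R ^- 2 : R)).
  have K2 : (K <= 2 ^ K)%N by apply/ltnW/ltn_expl.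
  rewrite [leRHS](big_cat_nat (leq0n K) K2) /= lerDl.
  by apply: sumr_ge0 => k _; rewrite invr_ge0 exprn_ge0.
apply: le_trans le2 _.
suff : (4 ^+ K.+2 / pi ^+ 2) * (\sum_(k < 2 ^ K) (2 * k + 1)%:R ^- 2) <= 2 * 4 ^+ K :> R.
  set S := \sum_(k < 2 ^ K) _.
  have -> : 4 ^+ K.+2 / pi ^+ 2 * S = 4 ^+ K * (16 * S / pi ^+ 2) by rewrite !exprS; ring.
  rewrite [2 * _]mulrC ler_pM2l ?exprn_gt0 // ler_pdivrMr ?exprn_gt0 //; lra.
rewrite -sum_csc2 mulr_sumr; apply: ler_sum => k _.
have /andP[a0 aI] := ang_itv (ltn_ord k).
have s0 : 0 < sin (ang K k) by apply: sin_gt0_pihalf; rewrite a0.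
have -> : 4 ^+ K.+2 / pi ^+ 2 * (2 * k + 1)%:R ^- 2 = (ang K k) ^- 2 :> R.
  rewrite /ang; have -> : 4 = 2 ^+ 2 :> R by ring.
  rewrite -exprM mulnC exprM.
  have h : (2 * k + 1)%:R != 0 :> R by rewrite pnatr_eq0 addn1.
  have h2 : 2 ^+ K.+2 != 0 :> R by rewrite expf_neq0 ?pnatr_eq0.
  have h3 : pi != 0 :> R by rewrite gt_eqF.
  move: (2 ^+ K.+2) ((2 * k + 1)%:R : R) (pi : R) h h2 h3 => x y z h h2 h3.
  by field; rewrite h h2 h3.
rewrite lef_pV2 ?posrE ?exprn_gt0 // ler_pXn2r // ?nnegrE ?(ltW a0) ?(ltW s0) //.
exact/sin_le_id/ltW.
Qed.

(* The term [k = 0] vanishes, since [0 ^-1 = 0]. *)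
Definition sum_inv2 (A : pred nat) (K : nat) : R :=
  \sum_(0 <= k < K) (if A k then k%:R ^- 2 else 0).

Lemma sum_inv2_mono A K K' : (K <= K')%N -> sum_inv2 A K <= sum_inv2 A K'.
Proof.
move=> KK; rewrite /sum_inv2 [leRHS](big_cat_nat (leq0n K) KK) /= lerDl.
by apply: sumr_ge0 => k _; case: ifP => // _; rewrite invr_ge0 exprn_ge0.
Qed.

(** In blocks of length [p] only the first index [i * p] is a multiple of [p], and it contributes
    [p ^- 2] times the term of [i]. *)
Lemma sum_inv2_split (A : pred nat) p K : (0 < p)%N ->
  (forall k, A (p * k)%N = A k) ->
  sum_inv2 A (K * p) =
  sum_inv2 (fun k => A k && ~~ (p %| k)%N) (K * p) + p%:R ^- 2 * sum_inv2 A K.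
Proof.
move=> p0 Ap; rewrite /sum_inv2 !big_nat_mul mulr_sumr -big_split /=.
apply: eq_bigr => i _.
have ip : (i * p < i.+1 * p)%N by rewrite ltn_mul2r p0 ltnSn.
have Ai : A (i * p)%N = A i by rewrite mulnC Ap.
rewrite !(big_ltn ip) Ai dvdn_mull // andbF add0r addrC.
congr (_ + _); last by case: ifP => _; rewrite ?mulr0 // natrM exprMn invfM mulrC.
apply: eq_big_nat => j /andP[j1 j2].
suff -> : ~~ (p %| j)%N by rewrite andbT.
apply/negP => /dvdnP[q jE]; move: j1 j2; rewrite jE !ltn_mul2r p0 /=; lia.
Qed.

(* Dividing multiples of [p] by [p] shows that they carry the fraction
   [p ^- 2] of the full sum, that is, of the supremum of the partial sums. *)
Lemma sum_inv2_sieve (A : pred nat) p C : (1 < p)%N ->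
  (forall k, A (p * k)%N = A k) -> (forall K, sum_inv2 A K <= C) ->
  forall K, sum_inv2 (fun k => A k && ~~ (p %| k)%N) K <= C * (1 - p%:R ^- 2).
Proof.
move=> p1 Ap AC K; have p0 := ltnW p1.
set A' := fun k => _; pose E := range (sum_inv2 A).
have supE : has_sup E.
  by split; [exists (sum_inv2 A 0), 0%N | exists C => _ [k _ <-]].
have pp : 0 < p%:R ^+ 2 :> R by rewrite exprn_gt0 // ltr0n.
have ubE k : sum_inv2 A k <= sup E.
  by apply: ub_le_sup => //; [case: supE | exists k].
have supC : sup E <= C by apply: ge_sup; [case: supE | move=> _ [k _ <-]].
have : sup E <= p%:R ^+ 2 * (sup E - sum_inv2 A' K).
  apply: ge_sup; first by case: supE.
  move=> _ [k _ <-]; rewrite -ler_pdivrMl // -/(p%:R ^- 2) lerBrDl.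
  (* This range covers [K] for the non-multiples and, after division by [p], also [k] for the
     multiples. *)
  apply: le_trans (ubE ((K + k) * p)%N).
  rewrite sum_inv2_split // -/A' lerD //; first by apply: sum_inv2_mono; nia.
  by rewrite ler_pM2l ?invr_gt0 // sum_inv2_mono // leq_addl.
rewrite mulrBr => h.
have q1 : 0 <= 1 - p%:R ^- 2 :> R.
  by rewrite subr_ge0 invf_le1 // exprn_ege1 // ler1n.
apply: le_trans (ler_wpM2r q1 supC).
rewrite -(ler_pM2l pp); have -> : p%:R ^+ 2 * (sup E * (1 - p%:R ^- 2)) = p%:R ^+ 2 * sup E - sup E.
  by field; rewrite pnatr_eq0 -lt0n.
lra.
Qed.

Lemma sum_inv2_coprime (Q : seq nat) : uniq Q -> all prime Q -> 2 \notin Q ->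
  forall K, sum_inv2 (fun k => odd k && all (fun p => ~~ (p %| k)%N) Q) K <=
            pi ^+ 2 / 8 * \prod_(p <- Q) (1 - p%:R ^- 2).
Proof.
elim: Q => [_ _ _ K|p Q IHQ /= /andP[pQ uQ] /andP[pp prQ]].
  rewrite big_nil mulr1; apply: le_trans (sum_odd_inv2 K).
  apply: (@le_trans _ _ (sum_inv2 (fun k => odd k && all (fun p => ~~ (p %| k)%N) [::]) (K * 2))).
    by apply: sum_inv2_mono; lia.
  rewrite /sum_inv2 big_nat_mul big_mkord le_eqVlt; apply/orP; left; apply/eqP.
  apply: eq_bigr => i _.
  have -> : (i.+1 * 2 = (i * 2).+2)%N by lia.
  rewrite big_ltn; last by lia.
  rewrite big_nat1 /= oddM andbF add0r /= mulnC; congr (_%:R ^- 2); lia.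
rewrite inE negb_or eq_sym => /andP[p2 Q2] K.
have IH := IHQ uQ prQ Q2; set A := fun k => _ in IH.
have Ap k : A (p * k)%N = A k.
  have po : odd p by case: (even_prime pp) p2 => // ->.
  rewrite /A oddM po /=; congr (_ && _); apply: eq_in_all => q qQ.
  have qp := allP prQ _ qQ; rewrite Euclid_dvdM // dvdn_prime2 //.
  by case: eqP => // qpE; move: pQ; rewrite -qpE qQ.
have := sum_inv2_sieve (prime_gt1 pp) Ap IH K.
rewrite big_cons mulrA mulrAC mulrC -mulrA [_ * (1 - _)]mulrC mulrA; apply: le_trans.
rewrite le_eqVlt; apply/orP; left; apply/eqP; apply: eq_bigr => k _.
by rewrite /A /= andbCA andbC.
Qed.

(** The index [1] survives every sieve, so the sum in [sum_inv2_coprime] is at least [1]. *)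
Lemma prod_odd_primes_inv2 (Q : seq nat) : uniq Q -> all prime Q -> 2 \notin Q ->
  8 / pi ^+ 2 <= \prod_(p <- Q) (1 - p%:R ^- 2) :> R.
Proof.
move=> uQ prQ Q2; have := sum_inv2_coprime uQ prQ Q2 2.
have p0 : 0 < pi ^+ 2 :> R by rewrite exprn_gt0 // pi_gt0.
rewrite /sum_inv2 big_ltn // big_nat1 /= add0r.
have -> : all (fun p => ~~ (p %| 1)%N) Q.
  by apply/allP => p /(allP prQ) pp; rewrite dvdn1 gtn_eqF // prime_gt1.
rewrite expr1n invr1 ler_pdivrMr //; lra.
Qed.

Lemma prod_primes_inv2 (P : seq nat) : uniq P -> all prime P ->
  6 / pi ^+ 2 <= \prod_(p <- P) (1 - p%:R ^- 2) :> R.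
Proof.
move=> uP prP; have p0 : 0 < pi ^+ 2 :> R by rewrite exprn_gt0 // pi_gt0.
have [P2|P2] := boolP (2%N \in P); last first.
  apply: le_trans (prod_odd_primes_inv2 uP prP P2).
  by rewrite ler_pM2r ?invr_gt0 //; lra.
rewrite (perm_big _ (perm_to_rem P2)) /= big_cons.
(* The prime [2] accounts for the factor [3 / 4] between the bound [8 / pi ^+ 2] for odd primes and
   [6 / pi ^+ 2]. *)
have -> : 6 / pi ^+ 2 = (1 - 2%:R ^- 2) * (8 / pi ^+ 2) :> R by rewrite mulrA; congr (_ / _); lra.
rewrite ler_pM2l; last by lra.
apply: prod_odd_primes_inv2; first exact: rem_uniq.
- by apply/allP => p /mem_rem /(allP prP).
by rewrite mem_rem_uniqF.
Qed.

End Trigo.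

(** * Sieving linear forms *)

(** Bezout's [u * q + v * a = 1] makes [v] an inverse of [a] modulo [q], so the solution is the
    class of [- b * v]. *)
Lemma linear_congruence (a b : int) (q : nat) : (0 < q)%N -> coprimez q a ->
  exists2 r, (r < q)%N & forall k : nat, (q %| a * k%:Z + b)%Z = (k %% q == r)%N.
Proof.
move=> q0 co; have /coprimezP[[u v] /= uv] := co.
have q0Z : q%:Z != 0 by rewrite -lt0n.
have r0 := modz_ge0 (- b * v) q0Z; have rq := ltz_mod (- b * v) q0Z.
exists `|((- b * v) %% q)%Z|%N; first by rewrite -ltz_nat gez0_abs.
move=> k; rewrite -eqz_nat -modz_nat gez0_abs // eqz_mod_dvd.
have -> : k%:Z - - b * v = v * (a * k%:Z + b) + q%:Z * (u * k%:Z).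
  by rewrite -[in LHS](mulr1 k%:Z) -uv; ring.
have eq_r : (q %| v * (a * k%:Z + b) + q%:Z * (u * k%:Z))%Z = (q %| v * (a * k%:Z + b))%Z.
  by apply: rpredDr; apply: dvdz_mulr.
rewrite eq_r Gauss_dvdzr //; apply/coprimezP; exists (u, a) => /=.
by rewrite -uv; ring.
Qed.

Definition affine (a b : int) (k : nat) : int := a * k%:Z + b.

Section Counting.
Local Open Scope nat_scope.

Lemma sum_nat_blocks (F : nat -> nat) T q :
  \sum_(0 <= k < T * q) F k = \sum_(0 <= r < q) \sum_(0 <= i < T) F (r + i * q).
Proof.
rewrite exchange_big big_nat_mul /=; apply: eq_bigr => i _.
by rewrite -{1}[i * q]add0n big_addn mulSn addnK.
Qed.

Lemma sum_dvd_linear (a b : int) (q T : nat) : 0 < q -> coprimez q a ->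
  \sum_(0 <= k < T * q) (q %| affine a b k)%Z = T.
Proof.
move=> q0 /(linear_congruence b q0)[r rq rP].
rewrite sum_nat_blocks big_mkord (bigD1 (Ordinal rq)) //= [X in _ + X]big1 ?addn0.
  rewrite (eq_big_nat _ _ (F2 := fun=> 1)) ?sum_nat_const_nat ?muln1 ?subn0 //.
  by move=> i _; rewrite /affine rP addnC modnMDl modn_small // eqxx.
move=> s sr; rewrite big1 // => i _; rewrite /affine rP addnC modnMDl modn_small //.
by rewrite (negPf (_ : val s != r)).
Qed.

Lemma sum_dvd_linear_le (a b : int) (q L : nat) : 0 < q -> coprimez q a ->
  \sum_(0 <= k < L) (q %| affine a b k)%Z <= L %/ q + 1.
Proof.
move=> q0 co; rewrite -[leqRHS](sum_dvd_linear b _ q0 co).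
have Lq : L <= (L %/ q + 1) * q by rewrite addn1 ltnW // ltn_ceil.
by rewrite [leqRHS](big_cat_nat (leq0n _) Lq) /= leq_addr.
Qed.

(** The Chinese remainder theorem by induction: for [k = r + i * q] the condition at [q] depends on
    [r] only and admits [q.-1] classes. In each of them the form is affine in [i] with slope
    [a * q], still coprime to the remaining moduli. *)
Lemma sieve_period (Q : seq nat) (a b : int) T :
  all (fun q => (0 < q) && coprimez q a) Q -> pairwise coprime Q ->
  \sum_(0 <= k < T * \prod_(q <- Q) q)
     all (fun q : nat => ~~ (q %| affine a b k)%Z) Q = T * \prod_(q <- Q) q.-1.
Proof.
elim: Q a b T => [|q Q IHQ] a b T /=.
  by rewrite !big_nil !muln1 sum_nat_const_nat subn0 muln1.
move=> /andP[/andP[q0 qa] Qa] /andP[qQ pQ].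
rewrite !big_cons [q * _]mulnC mulnA sum_nat_blocks.
have aux r : \sum_(0 <= i < T * \prod_(j <- Q) j)
    (~~ (q %| affine a b (r + i * q))%Z &&
     all (fun q0 : nat => ~~ (q0 %| affine a b (r + i * q))%Z) Q) =
    ~~ (q %| affine a b r)%Z * (T * \prod_(j <- Q) j.-1).
  have Qaq : all (fun q' => (0 < q') && coprimez q' (a * q%:Z)%R) Q.
    apply/allP => q' q'Q; have /andP[-> q'a] := allP Qa _ q'Q.
    rewrite coprimezMr q'a /= coprimezE /= coprime_sym.
    exact: (allP qQ).
  rewrite -(IHQ (a * q%:Z)%R (affine a b r) T Qaq pQ) big_distrr /=.
  apply: eq_bigr => i _.
  have e : affine a b (r + i * q) = affine (a * q%:Z) (affine a b r) i.
    by rewrite /affine PoszD PoszM; ring.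
  have -> : (q %| affine a b (r + i * q))%Z = (q %| affine a b r)%Z.
    by rewrite e; apply: rpredDl; rewrite -mulrA dvdz_mull // dvdz_mulr.
  by rewrite e; case: (_ \in _) => //=; rewrite mul1n.
rewrite (eq_bigr _ (fun r _ => aux r)) -big_distrl /=.
have := sum_dvd_linear b 1 q0 qa; rewrite mul1n => s1.
have : \sum_(0 <= r < q) ((q %| affine a b r)%Z + ~~ (q %| affine a b r)%Z) = q.
  rewrite (eq_bigr (fun=> 1)) ?sum_nat_const_nat ?subn0 ?muln1 //.
  by move=> r _; case: (_ \in _).
rewrite big_split /= s1 => qE.
by rewrite -[in RHS]qE /= mulnCA.
Qed.

(** Telescoping, from [z.+1 ^- 2 <= z^-1 - z.+1^-1]. *)
Lemma sum_inv2_tail (R : realType) (K y Z : nat) : 0 < K -> K < y ->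
  (\sum_(y <= p < Z) p%:R ^- 2 <= K%:R^-1 :> R)%R.
Proof.
move=> K0 Ky; have [Zy|yZ] := leqP Z y; first by rewrite big_geq // invr_ge0.
have tele j : (\sum_(y <= p < (K + j).+1) p%:R ^- 2 <= K%:R^-1 - (K + j)%:R^-1 :> R)%R.
  elim: j => [|j IHj]; first by rewrite addn0 subrr big_geq.
  rewrite addnS; set z := K + j in IHj *; have z0 : 0 < z by rewrite addn_gt0 K0.
  have stepz : (z.+1%:R ^- 2 <= z%:R^-1 - z.+1%:R^-1 :> R)%R.
    have zR : (0 < z%:R :> R)%R by rewrite ltr0n.
    have z1R : (0 < z%:R + 1 :> R)%R by lra.
    rewrite -natr1; have -> : (z%:R^-1 - (z%:R + 1)^-1 = (z%:R * (z%:R + 1))^-1 :> R)%R.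
      by field; rewrite !gt_eqF.
    by rewrite lef_pV2 ?posrE ?mulr_gt0 ?exprn_gt0 //; nra.
  have [yz|zy] := leqP y z.+1; first rewrite big_nat_recr //=.
    by apply: le_trans (lerD IHj stepz) _; rewrite addrA subrK.
  by rewrite big_geq // subr_ge0 lef_pV2 ?posrE ?ltr0n // ler_nat /z; lia.
have -> : Z = (K + (Z.-1 - K)).+1 by lia.
by apply: le_trans (tele _) _; rewrite gerBl invr_ge0.
Qed.

Lemma count_symE (S : int -> Prop) N :
  count_sym S N = \sum_(0 <= k < (2 * N).+1) `[< S (k%:Z - N%:Z)%R >].
Proof.
rewrite /count_sym big_mkord -sum1_card big_mkcond /=.
by apply: eq_bigr => k _; rewrite inE; case: asbool.
Qed.

(** One sieve serves both conditions on [d]: [C] is the set of primes dividing [c] for [d] itself,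
    and is empty for [hdisc]. *)
Definition sieve_mod (C : pred nat) (p : nat) : nat := if C p then p else p ^ 2.

Definition sieve_primes (sel : pred nat) (y : nat) : seq nat :=
  [seq p <- index_iota 0 y | prime p && sel p].

Lemma sieve_primes_uniq sel y : uniq (sieve_primes sel y).
Proof. by rewrite filter_uniq // iota_uniq. Qed.

Lemma mem_sieve_primes sel y p :
  (p \in sieve_primes sel y) = [&& prime p, sel p & p < y].
Proof. by rewrite mem_filter mem_index_iota /= andbA. Qed.

Definition sieved (a b : int) (sel C : pred nat) (d : int) : Prop :=
  forall p, prime p -> sel p -> ~ (sieve_mod C p %| (a * d + b)%R)%Z.

Section Sieve.
Variables (a b : int) (sel C : pred nat) (y0 : nat).
Hypothesis a0 : a != 0%R.
Hypothesis coa : forall p, prime p -> sel p -> coprime p `|a|.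
Hypothesis Cfin : forall p, y0 <= p -> ~~ C p.

Let modulus := sieve_mod C.

Lemma sieve_mod_gt0 p : prime p -> 0 < modulus p.
Proof.
move=> /prime_gt0; rewrite /modulus /sieve_mod.
by case: ifP => // _; rewrite expn_gt0 => ->.
Qed.

Lemma coprime_sieve_mod p k : prime p -> coprime (modulus p) k = coprime p k.
Proof.
move=> pp; rewrite /modulus /sieve_mod.
by case: ifP => // _; rewrite coprime_pexpl.
Qed.

(** An index that survives the primes below [y] but is not sieved has a value divisible by [p ^ 2]
    for some [p >= y]. A nonzero value is below [X.+1 ^ 2] in size, so [p <= X]; the final [1] pays
    for the at most one index where the form vanishes. *)
Lemma sieve_count_ge N y X : y0 <= y -> `|a| * N + `|b| < X.+1 ^ 2 ->
  ((2 * N).+1 %/ \prod_(p <- sieve_primes sel y) modulus p) *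
    \prod_(p <- sieve_primes sel y) (modulus p).-1 <=
  count_sym (sieved a b sel C) N + \sum_(y <= p < X.+1) ((2 * N).+1 %/ p ^ 2 + 1) + 1.
Proof.
(* The constant [b'] absorbs the shift between the index [k] and [d = k - N]. *)
move=> y0y aX; set L := (2 * N).+1; set P := sieve_primes sel y; pose b' : int := (b - a * N%:Z)%R.
have vE (k : nat) : affine a b' k = (a * (k%:Z - N%:Z) + b)%R.
  by rewrite /affine /b'; ring.
have PQ : all (fun q => (0 < q) && coprimez q a) (map modulus P).
  apply/allP => _ /mapP[p + ->]; rewrite mem_sieve_primes => /and3P[pp sp _].
  by rewrite sieve_mod_gt0 //= coprimezE /= coprime_sieve_mod // coa.
have coP : pairwise coprime (map modulus P).
  rewrite pairwise_map; apply: (sub_in_pairwise (P := mem P)) (_ : pairwise (fun p q => p != q) P).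
  - move=> p q; rewrite /= !mem_sieve_primes => /and3P[pp _ _] /and3P[pq _ _] pq'.
    rewrite /= coprime_sieve_mod // coprime_sym coprime_sieve_mod // prime_coprime //.
    by rewrite dvdn_prime2 // eq_sym.
  - by apply/allP.
  - by rewrite -uniq_pairwise sieve_primes_uniq.
have := sieve_period b' (L %/ \prod_(p <- P) modulus p) PQ coP.
rewrite !big_map => <-.
set M := \prod_(p <- P) modulus p.
have ML : L %/ M * M <= L by exact: leq_trunc_div.
apply: (@leq_trans (\sum_(0 <= k < L)
    all (fun q : nat => ~~ (q %| affine a b' k)%Z) (map modulus P))).
  by rewrite [leqRHS](big_cat_nat (leq0n _) ML) /= leq_addr.
apply: (@leq_trans (\sum_(0 <= k < L) (`[< sieved a b sel C (k%:Z - N%:Z)%R >] +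
   \sum_(y <= p < X.+1 | prime p && sel p) ((p ^ 2)%N %| affine a b' k)%Z +
   (affine a b' k == 0%R)))); last first.
  rewrite [leqLHS]big_split [X in X + _ <= _]big_split /= count_symE.
  rewrite leq_add ?leq_add //; last first.
    rewrite big_mkord; case: (pickP (fun k : 'I_L => affine a b' k == 0%R)) => [k0 /eqP k00|n0].
      rewrite (bigD1 k0) //= k00 eqxx big1 // => k kk0; case: eqP => // k1.
      have : (a * (k%:Z - k0%:Z) = 0)%R.
        by have <- : (affine a b' k - affine a b' k0 = 0)%R; [rewrite k1 k00|rewrite /affine; ring].
      move=> /eqP; rewrite mulf_eq0 (negPf a0) /= subr_eq0 eqz_nat => kk.
      by move: kk0; rewrite -val_eqE /= kk.
    by rewrite big1 // => k _; rewrite n0.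
  rewrite exchange_big /= [leqLHS]big_mkcond; apply: leq_sum => p _.
  case: ifP => // /andP[pp sp].
  apply: sum_dvd_linear_le; first by rewrite expn_gt0 prime_gt0.
  by rewrite coprimezE /= coprime_pexpl // coa.
rewrite big_nat [leqRHS]big_nat; apply: leq_sum => k /andP[_ kL].
case: (boolP (all _ _)) => // /allP allQ.
case: (pselect (sieved a b sel C (k%:Z - N%:Z)%R)) => [g|].
  by rewrite asboolT // -addnA leq_addr.
move=> /existsNP[p /not_implyP[pp /not_implyP[sp /contrapT pv]]].
rewrite -vE in pv.
have yp : y <= p.
  rewrite leqNgt; apply/negP => py.
  have pP : p \in P by rewrite mem_sieve_primes pp sp.
  by have := allQ _ (map_f modulus pP); rewrite pv.
move: pv; rewrite /sieve_mod (negPf (Cfin (leq_trans y0y yp))) => pv.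
have [v0|v0] := eqVneq (affine a b' k) 0%R; first by rewrite addn1.
rewrite addn0; apply: leq_trans (leq_addl _ _).
have pX : p < X.+1.
  rewrite -ltn_sqr; apply: leq_ltn_trans aX.
  apply: (@leq_trans `|affine a b' k|).
    by apply: dvdn_leq; [rewrite absz_gt0|move: pv; rewrite dvdzE].
  have kN : `|k%:Z - N%:Z| <= N by rewrite /L in kL; lia.
  rewrite vE; apply: (@leq_trans (`|(a * (k%:Z - N%:Z))%R| + `|b|)); first by lia.
  by rewrite leq_add2r abszM leq_mul2l kN orbT.
rewrite big_mkcond (bigD1_seq p) ?mem_index_iota ?yp ?pX ?iota_uniq //=.
by rewrite pp sp pv.
Qed.

Local Open Scope ring_scope.

(** The loss is at most [M] for the incomplete period, [L / K] for the tail of the squares,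
    [X.+1 <= L / K + 1] for the rounding terms, and [1]. Each of [L / K], [L / K] and [M + 2] is at
    most [L * (eps / 3)]. *)
Lemma sieve_density (R : realType) (B : R) :
  (forall y, (y0 <= y)%N -> B <= \prod_(p <- sieve_primes sel y) (1 - (modulus p)%:R^-1)) ->
  density_lower_bound (sieved a b sel C) B.
Proof.
move=> BP eps eps0.
pose K := (Num.truncn (3 / eps)).+1.
have KE : K%:R^-1 <= eps / 3.
  rewrite -[eps / 3]invrK lef_pV2 ?posrE ?ltr0n ?invr_gt0 ?divr_gt0 // invf_div.
  exact/ltW/truncnS_gt.
pose y := (y0 + K).+1; pose P := sieve_primes sel y.
pose M := (\prod_(p <- P) modulus p)%N.
have prP p : p \in P -> prime p by rewrite mem_sieve_primes => /and3P[].
have M0 : (0 < M)%N.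
  by rewrite /M big_seq prodn_cond_gt0 // => p /prP /sieve_mod_gt0.
(* The first summand ensures that [X = L %/ K] exceeds the square root of all values of the form,
   the second that [M + 2 <= L * (eps / 3)]. *)
pose L0 := (K ^ 2 * (`|a| + `|b|) + Num.truncn (3 * (M + 2)%:R / eps)).+1%N.
exists L0 => N L0N; set L := (2 * N).+1.
have L0L : (L0 <= L)%N by rewrite /L; lia.
have L_gt0 : 0 < L%:R :> R by rewrite ltr0n.
pose X := (L %/ K)%N.
have aX : (`|a| * N + `|b| < X.+1 ^ 2)%N.
  have KX : (L < K * X.+1)%N by rewrite mulnC ltn_ceil.
  have LK : (K ^ 2 * (`|a| + `|b|) <= L)%N by rewrite /L0 in L0L; lia.
  have : (K ^ 2 * (`|a| * N + `|b|) < K ^ 2 * X.+1 ^ 2)%N.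
    rewrite -expnMn; apply: leq_ltn_trans (_ : (L ^ 2 < _)%N); last by rewrite ltn_sqr.
    apply: (@leq_trans (K ^ 2 * (`|a| + `|b|) * L)%N); last by rewrite -mulnn leq_mul2r LK orbT.
    rewrite -mulnA leq_mul2l mulnDl; apply/orP; right; apply: leq_add.
      by rewrite leq_mul2l; apply/orP; right; rewrite /L; lia.
    by rewrite leq_pmulr.
  by rewrite ltn_pmul2l // expn_gt0.
have := sieve_count_ge (leq_trans (leq_addr K y0) (leqnSn _)) aX.
rewrite -/y -/P -/L -/M -(ler_nat R) => cnt.
rewrite ler_pdivlMr //.
have PR : (\prod_(p <- P) (modulus p).-1)%:R = M%:R * \prod_(p <- P) (1 - (modulus p)%:R^-1) :> R.
  rewrite /M !natr_prod -big_split /= big_seq [RHS]big_seq; apply: eq_bigr => p /prP pp.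
  have m0 := sieve_mod_gt0 pp.
  rewrite -subn1 natrB // mulrBr mulr1 divff // pnatr_eq0 -lt0n //.
set pr := \prod_(p <- P) _ in PR.
have f01 p : prime p -> (0 <= 1 - (modulus p)%:R^-1 :> R) && (1 - (modulus p)%:R^-1 <= 1 :> R).
  move=> /sieve_mod_gt0 m0; apply/andP; split; last by rewrite gerBl invr_ge0.
  by rewrite subr_ge0 invf_le1 ?ltr0n // ler1n.
have pr01 : 0 <= pr <= 1.
  rewrite /pr big_seq; apply/andP; split.
    by apply: prodr_ge0 => p /prP /f01 /andP[].
  by apply: prodr_ile1 => p /prP /f01.
have Tge : L%:R - M%:R <= (L %/ M)%:R * M%:R :> R.
  rewrite lerBlDr -natrM -natrD ler_nat.
  by rewrite -mulSnr ltnW // ltn_ceil.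
have tail : \sum_(y <= p < X.+1) (L %/ p ^ 2 + 1)%:R <= L%:R / K%:R + (X.+1)%:R :> R.
  apply: (@le_trans _ _ (\sum_(y <= p < X.+1) (L%:R * p%:R ^- 2 + 1))).
    rewrite big_nat [leRHS]big_nat; apply: ler_sum => p /andP[yp _].
    rewrite natrD lerD2r ler_pdivlMr -?natrX ?ltr0n ?expn_gt0; last by rewrite /y in yp; lia.
    by rewrite -natrM ler_nat leq_trunc_div.
  rewrite big_split /= -mulr_sumr lerD //.
    by rewrite ler_pM2l // sum_inv2_tail // /y; lia.
  by rewrite sumr_const_nat ler_nat; lia.
have XL : X%:R <= L%:R / K%:R :> R.
  by rewrite ler_pdivlMr ?ltr0n // -natrM ler_nat leq_trunc_div.
have main : (B - eps) * L%:R <= L%:R * pr - M%:R - 2 * (L%:R / K%:R) - 2.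
  have h1 : L%:R / K%:R <= L%:R * (eps / 3) by rewrite ler_pM2l.
  have h2 : (M + 2)%:R <= L%:R * (eps / 3).
    have : 3 * (M + 2)%:R / eps < L%:R.
      apply: (@lt_le_trans _ _ (Num.truncn (3 * (M + 2)%:R / eps)).+1%:R).
        exact: truncnS_gt.
      by rewrite ler_nat; apply: leq_trans L0L; rewrite ltnS leq_addl.
    rewrite ltr_pdivrMr //; lra.
  have h3 : B * L%:R <= L%:R * pr by rewrite mulrC ler_pM2l // BP // /y; lia.
  rewrite natrD in h2; lra.
apply: le_trans main _.
move: cnt; rewrite natrM PR !natrD natr_sum mulrA => cnt.
have c2 : (L%:R - M%:R) * pr <= (L %/ M)%:R * M%:R * pr.
  by rewrite ler_wpM2r //; case/andP: pr01.
have c3 : L%:R * pr - M%:R <= (L%:R - M%:R) * pr.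
  rewrite mulrBl lerB // ler_piMr //; by case/andP: pr01.
rewrite -natr1 in tail; lra.
Qed.

End Sieve.

End Counting.

(** * Densities *)

Section Density.
Variable R : realType.

Lemma prod_prime_divisors (m y : nat) (G : nat -> R) : (0 < m)%N -> (m < y)%N ->
  \prod_(p <- sieve_primes predT y) (if (p %| m)%N then G p else 1) =
  \prod_(p <- primes m) G p.
Proof.
move=> m0 my; rewrite -big_mkcond -big_filter; apply: perm_big.
apply: uniq_perm; [exact/filter_uniq/sieve_primes_uniq|exact: primes_uniq|move=> p].
rewrite mem_filter mem_sieve_primes mem_primes m0 /=.
case pm : (p %| m)%N; rewrite ?andbF //= andbT.
by rewrite (leq_ltn_trans (dvdn_leq m0 pm) my) andbT.
Qed.

(** Each local density is the Euler factor [1 - p ^- 2] with a correction [G p] at the primes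
    dividing [m], all of which lie below [y]. *)
Lemma prod_sieve_primes_ge (m y : nat) (F G : nat -> R) :
  (0 < m)%N -> (m < y)%N ->
  (forall p, prime p -> 0 <= G p) ->
  (forall p, prime p ->
     F p = (1 - p%:R ^- 2) * (if (p %| m)%N then G p else 1)) ->
  6 / pi ^+ 2 * \prod_(p <- primes m) G p <= \prod_(p <- sieve_primes predT y) F p.
Proof.
move=> m0 my G0 FE; rewrite -(prod_prime_divisors G m0 my).
have prP p : p \in sieve_primes predT y -> prime p.
  by rewrite mem_sieve_primes => /andP[].
rewrite [leRHS]big_seq (eq_bigr _ (fun p h => FE p (prP p h))) -big_seq big_split /=.
rewrite ler_wpM2r //.
  by rewrite big_seq; apply: prodr_ge0 => p /prP pp; case: ifP => // _; exact: G0.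
by apply: prod_primes_inv2; [exact: sieve_primes_uniq|apply/allP].
Qed.

Lemma density_lower_bound_inter (S1 S2 S : int -> Prop) (B1 B2 : R) :
  density_lower_bound S1 B1 -> density_lower_bound S2 B2 ->
  (forall d, S1 d -> S2 d -> S d) -> density_lower_bound S (B1 - (1 - B2)).
Proof.
move=> D1 D2 SS eps eps0; have eps2 : 0 < eps / 2 by rewrite divr_gt0.
have [N1 h1] := D1 _ eps2; have [N2 h2] := D2 _ eps2.
exists (maxn N1 N2) => N; rewrite geq_max => /andP[/h1 {}h1 /h2 {}h2].
have L0 : 0 < (2 * N).+1%:R :> R by rewrite ltr0n.
move: h1 h2; rewrite !ler_pdivlMr // => h1 h2.
have : (count_sym S1 N + count_sym S2 N <= count_sym S N + (2 * N).+1)%N.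
  rewrite !count_symE -{4}[(2 * N).+1]subn0 -[X in (_ <= _ + X)%N]muln1.
  rewrite -sum_nat_const_nat -!big_split /=; apply: leq_sum => k _.
  case: (asboolP (S1 _)) => s1; case: (asboolP (S2 _)) => s2 //=; rewrite ?addn1 //.
  by rewrite asboolT //; exact: SS.
rewrite -(ler_nat R) !natrD; lra.
Qed.

Lemma density_sqfree_coprime (c : int) : c != 0 ->
  density_lower_bound (sieved 1 0 predT (fun p => (p %| `|c|)%N))
    (6 / (pi ^+ 2) * \prod_(p <- primes `|c|) (p%:R / (p%:R + 1)) : R).
Proof.
move=> c0; have ac0 : (0 < `|c|)%N by rewrite absz_gt0.
apply: (@sieve_density _ _ _ _ `|c|.+1) => //.
- by move=> p _ _; rewrite coprimen1.
- by move=> p cp; apply/negP => /(dvdn_leq ac0); rewrite leqNgt cp.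
move=> y cy; apply: prod_sieve_primes_ge => // p pp.
  by rewrite divr_ge0 // addr_ge0.
have pR : 0 < p%:R :> R by rewrite ltr0n prime_gt0.
rewrite /sieve_mod; case: ifP => _; last by rewrite natrX mulr1.
have p1R : 0 < p%:R + 1 :> R by lra.
(* For [p] dividing [c]: [1 - p^-1 = (1 - p ^- 2) * (p / (p + 1))]. *)
by field; rewrite !gt_eqF.
Qed.

Lemma density_sqfree_disc (n : nat) (b : int) : (1 < n)%N ->
  density_lower_bound (sieved (n%:Z ^+ n) b (fun p => ~~ (p %| n)%N) pred0)
    (6 / (pi ^+ 2) * \prod_(p <- primes n) (p%:R ^+ 2 / (p%:R ^+ 2 - 1)) : R).
Proof.
move=> n1; have n0 := ltnW n1.
apply: (@sieve_density _ _ _ _ n.+1) => //.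
- by rewrite expf_neq0 // -lt0n.
- by move=> p pp pn; rewrite abszX /= coprimeXr // prime_coprime.
move=> y ny.
(* The primes dividing [n] are put back with factor [1], which is
   [(1 - p ^- 2) * (p ^+ 2 / (p ^+ 2 - 1))]. *)
have -> : \prod_(p <- sieve_primes (fun p => ~~ (p %| n)%N) y)
     (1 - (sieve_mod pred0 p)%:R^-1) =
   \prod_(p <- sieve_primes predT y)
     (if ~~ (p %| n)%N then 1 - (sieve_mod pred0 p)%:R^-1 else 1) :> R.
  rewrite -big_mkcond -[RHS]big_filter -filter_predI; congr (\prod_(p <- _) _).
  by apply: eq_filter => p /=; rewrite andbT andbC.
apply: prod_sieve_primes_ge => // p pp; have p1 := prime_gt1 pp.
  have pR : 1 < p%:R :> R by rewrite ltr1n.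
  by rewrite divr_ge0 ?exprn_ge0 //; nra.
rewrite /sieve_mod /=; case: (p %| n)%N => /=; last by rewrite natrX mulr1.
have pR : 1 < p%:R :> R by rewrite ltr1n.
have p2 : p%:R ^+ 2 - 1 != 0 :> R by rewrite gt_eqF //; nra.
by field; rewrite p2 gt_eqF //; lra.
Qed.

(** The product over [c] is at least [2 / 3]: one prime gives [p / (p + 1) >= 2 / 3], and two primes
    from [5] on give at least [25 / 36]. The product over [n] is at least [1], so
    [B >= 5 / 3 * (6 / pi ^+ 2) - 1], which is positive as [pi ^+ 2 < 10]. *)
Lemma Bconst_gt0 (n : nat) (c : int) : (2 < n)%N ->
  (size (primes `|c|) == 1)%N \/
   ((size (primes `|c|) == 2)%N && coprime `|c| 6) -> 0 < Bconst R n c.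
Proof.
move=> n2 hc; have pi0 : 0 < pi ^+ 2 :> R by rewrite exprn_gt0 // pi_gt0.
have factor_ge k p : (k <= p)%N -> k%:R / (k%:R + 1) <= p%:R / (p%:R + 1) :> R.
  move=> kp; have k0 : 0 <= k%:R :> R by []; have p0 : 0 <= p%:R :> R by [].
  have kpR : k%:R <= p%:R :> R by rewrite ler_nat.
  by rewrite ler_pdivrMr ?ltr_wpDl // mulrAC ler_pdivlMr ?ltr_wpDl //; nra.
have A : 2 / 3 <= \prod_(p <- primes `|c|) (p%:R / (p%:R + 1)) :> R.
  case: hc => [/eqP s1|/andP[/eqP s2 c6]].
    case E : (primes `|c|) s1 => [|p [|? ?]] // _; rewrite big_seq1.
    have : p \in primes `|c| by rewrite E inE eqxx.
    rewrite mem_primes => /andP[pp _].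
    have := factor_ge _ _ (prime_gt1 pp).
    by have -> : 2%:R + 1 = 3 :> R by lra.
  have ge5 p : p \in primes `|c| -> (5 <= p)%N.
    rewrite mem_primes => /and3P[pp _ pc].
    have : coprime p 6 by exact: coprime_dvdl pc c6.
    by case: p pp {pc} => [|[|[|[|[|p]]]]].
  case E : (primes `|c|) s2 => [|p [|q [|? ?]]] // _; rewrite big_cons big_seq1.
  have p5 : (5 <= p)%N by apply: ge5; rewrite E inE eqxx.
  have q5 : (5 <= q)%N by apply: ge5; rewrite E !inE eqxx orbT.
  have := factor_ge _ _ p5; have := factor_ge _ _ q5.
  have -> : 5%:R + 1 = 6 :> R by lra.
  by move: (p%:R / _) (q%:R / _) => u v; nra.
have Bn : 1 <= \prod_(p <- primes n) (p%:R ^+ 2 / (p%:R ^+ 2 - 1)) :> R.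
  rewrite big_seq; elim/big_ind : _ => // [x y x1 y1|p].
    by nra.
  rewrite mem_primes => /andP[/prime_gt1 p1 _].
  have pR : 1 < p%:R :> R by rewrite ltr1n.
  by rewrite ler_pdivlMr; nra.
rewrite /Bconst.
have h10 := @pi_sqr_lt10 R.
have six : 3 / 5 < 6 / pi ^+ 2 :> R by rewrite ltr_pdivlMr //; lra.
move: (6 / _) six (\prod_(p <- primes `|c|) _) A (\prod_(p <- primes n) _) Bn => z hz u hu v hv.
nra.
Qed.

(** Otherwise [S] would have at most [2 * M + 1] elements, fewer than the proportion [B / 2]
    requires once [N] is large. *)
Lemma density_unbounded (S : int -> Prop) (B : R) : 0 < B ->
  density_lower_bound S B -> forall M : nat, exists d : int, (M < `|d|)%N /\ S d.
Proof.
move=> B0 D M; apply: contrapT => noS.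
have B2 : 0 < B / 2 by rewrite divr_gt0.
have [N0 /= hN] := D _ B2.
pose N := (N0 + M + Num.truncn ((2 * M).+1%:R / (B / 2)))%N.
have cle : (count_sym S N <= (2 * M).+1)%N.
  rewrite count_symE.
  have l1 : (N - M <= (2 * N).+1)%N by lia.
  have l2 : (N - M <= N + M + 1)%N by lia.
  have l3 : (N + M + 1 <= (2 * N).+1)%N by rewrite /N; lia.
  have out (k : nat) : (M < `|k%:Z - N%:Z|)%N -> nat_of_bool `[< S (k%:Z - N%:Z) >] = 0%N.
    by move=> Mk; rewrite asboolF // => Sk; apply: noS; exists (k%:Z - N%:Z).
  rewrite (big_cat_nat (leq0n _) l1) (big_cat_nat l2 l3) /=.
  rewrite big_nat big1 ?add0n => [|k /andP[_ kN]]; last by apply: out; lia.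
  rewrite [X in (_ + X)%N]big_nat [X in (_ + X)%N]big1 ?addn0 => [|k /andP[kN _]]; last first.
    by apply: out; lia.
  apply: (@leq_trans (\sum_(N - M <= k < N + M + 1) 1)%N).
    by apply: leq_sum => k _; exact: leq_b1.
  by rewrite sum_nat_const_nat muln1; lia.
have NN0 : (N0 <= N)%N by rewrite /N -addnA leq_addr.
have := hN N NN0; apply/negP; rewrite -ltNge.
have L0 : 0 < (2 * N).+1%:R :> R by rewrite ltr0n.
have -> : B - B / 2 = B / 2 by lra.
rewrite ltr_pdivrMr // mulrC -ltr_pdivrMr //.
apply: le_lt_trans (_ : (2 * M).+1%:R / (B / 2) < _).
  by rewrite ler_pM2r ?invr_gt0 // ler_nat.
apply: lt_le_trans (truncnS_gt _) _; rewrite ler_nat ltnS /N.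
by move: (Num.truncn _) => t; lia.
Qed.

End Density.

Theorem theorem3p6 (R : realType) (n : nat) (c : int) :
  (2 < n)%N -> c != 0 -> squarefree c -> c != 1 -> c != -1 ->
  density_lower_bound (good_d n c) (Bconst R n c) /\
  ((size (primes `|c|) == 1)%N \/
   ((size (primes `|c|) == 2)%N && coprime `|c| 6) ->
     0 < Bconst R n c /\ forall M : nat, exists d : int, (M < `|d|)%N /\ good_d n c d).
Proof.
move=> n2 c0 sqc c1 cN1.
have D : density_lower_bound (good_d n c) (Bconst R n c).
  (* As a function of [d], [hdisc n c d] is the linear form with slope [n ^+ n] and the constant
     term given here. *)
  apply: (density_lower_bound_inter (@density_sqfree_coprime R c c0)
    (@density_sqfree_disc R n ((- (n.-1%:Z * c)) ^+ n.-1) (ltnW n2))) => d dA dB.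
  apply: good_d_criterion => // p pp.
  by have := dA p pp isT; rewrite mul1r addr0.
split=> // /(@Bconst_gt0 R n c n2) B0; split=> //.
exact: density_unbounded B0 D.
Qed.
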